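(* Let $(X,\Sigma,\mu)$ be a complete $\sigma$-finite measure space and let $T:X\to X$ be a non-singular measurable transformation such that the composition operator $C_T f=f\circ T$ is bounded on $L^2(\mu)$. Assume that $T^{-k}(\Sigma)=\Sigma$ for all $k\in\mathbb{N}$. Let $k\geq 0$ and $n\geq 1$ be integers. Then: (i) $C_T$ is $k$-quasi $n$-power posinormal if and only if there exists $\lambda>0$ such that for all $f\in L^2(\mu)$, $$\lambda\,\bigl\|\sqrt{h_{k+1}}\,f\bigr\|\ \geq\ \bigl\|\sqrt{h_k\cdot (h_n\circ T^{\,n-k})}\,f\bigr\|.$$ (ii) $C_T^*$ is $k$-quasi $n$-power posinormal if and only if there exists $\lambda>0$ such that for all $f\in L^2(\mu)$, $$\lambda\,\bigl\|\sqrt{h_{k+1}\circ T^{k+1}}\,f\bigr\|\ \geq\ \bigl\|\sqrt{(h_n h_k)\circ T^k}\,f\bigr\|.$$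
   Context: A bounded operator $A$ on a complex Hilbert space is called $k$-quasi $n$-power posinormal if there is $\lambda>0$ with $A^{*k}(\lambda^2A^*A-A^nA^{*n})A^k\ge 0$. A measurable transformation $T$ (i.e. $T^{-1}(S)\in\Sigma$ for $S\in\Sigma$) is non-singular if $\mu(T^{-1}(S))=0$ whenever $\mu(S)=0$. For $k\in\mathbb{N}$, $T^k$ is the $k$-fold iterate and $h_k=\frac{d(\mu\circ T^{-k})}{d\mu}$ is the Radon-Nikodym derivative of the measure $S\mapsto\mu(T^{-k}(S))$ with respect to $\mu$; $h=h_1$, $h_0=1$, $T^0=\mathrm{id}$. $T^{-k}(\Sigma)=\{T^{-k}(S):S\in\Sigma\}$. For $m\ge1$ and a measurable function $f$, since $T^{-m}(\Sigma)=\Sigma$ there is a $\Sigma$-measurable $g$ with $g\circ T^m=f$ $\mu$-a.e., unique $\mu$-a.e. on $\{h_m\neq 0\}$; $f\circ T^{-m}$ denotes this $g$, taken to be $0$ on $\{h_m=0\}$. This is the meaning of $h_n\circ T^{\,n-k}$ when $n<k$. Norms are those of $L^2(\mu)$. *)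

(* Defs.v *)
From HB Require Import structures.
From mathcomp Require Import all_boot all_order all_algebra.
From mathcomp Require Import sesquilinear generic_quotient ring_quotient.
From mathcomp Require Import all_classical all_reals all_analysis.
From mathcomp Require Import measurable_realfun complex.

Set Implicit Arguments.
Unset Strict Implicit.
Unset Printing Implicit Defensive.

Import Order.TTheory GRing.Theory Num.Theory.
Import numFieldNormedType.Exports.
Import ComplexField.Normc.

Local Open Scope classical_set_scope.
Local Open Scope ring_scope.
Local Open Scope complex_scope.
Local Open Scope quotient_scope.

(* H is a complex inner product space, whose inner product ip is linear in its
   first argument. Completeness of H is only needed for the existence of
   adjoints, not for the definitions. *)
Section Operators.
Context (R : realType) (H : lmodType R[i]) (ip : {dot H for Num.conj}).

Definition hnorm (x : H) : R := Num.sqrt (complex.Re (ip x x)).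

Definition bounded_operator (A : H -> H) :=
  linear A /\ exists M : R, forall x, hnorm (A x) <= M * hnorm x.

(* Where the functional x |-> <A x, y> is represented by a vector, this vector
   is unique because ip is definite. *)
Definition adjoint (A : H -> H) (y : H) : H :=
  xget 0 [set z | forall x, ip (A x) y = ip x z].

(* In R[i], 0 <= z means that z is real and nonnegative. *)
Definition positive_operator (B : H -> H) := forall x, 0 <= ip (B x) x.

Definition quasi_posinormal (k n : nat) (A : H -> H) :=
  bounded_operator A /\
  exists2 lam : R, 0 < lam &
    positive_operator (fun x =>
      iter k (adjoint A)
        ((lam ^+ 2)%:C *: adjoint A (A (iter k A x))
         - iter n A (iter n (adjoint A) (iter k A x)))).

End Operators.

Section L2functions.
Context d (X : measurableType d) (R : realType).
Variable mu : {measure set X -> \bar R}.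
Implicit Types f g : X -> R[i].

Definition cmeasurable f :=
  measurable_fun [set: X] (fun x => complex.Re (f x)) /\
  measurable_fun [set: X] (fun x => complex.Im (f x)).

Definition L2norm f : \bar R := 'N[mu]_2%:E[(fun x => (normc (f x))%:E)].

Definition L2fun : {pred X -> R[i]} :=
  fun f => `[< cmeasurable f /\ (L2norm f < +oo)%E >].

Definition cintegral f : R[i] :=
  (\int[mu]_x complex.Re (f x)) +i* (\int[mu]_x complex.Im (f x)).

Definition inner f g : R[i] := cintegral (fun x => f x * (g x)^*).

Lemma Lfun2_dom (u v : X -> R) : measurable_fun [set: X] u ->
  (forall x, `|u x| <= `|v x|) -> v \in Lfun mu 2%:E -> u \in Lfun mu 2%:E.
Proof.
move=> mu' uv; rewrite !inE => /andP[]; rewrite !inE/= /finite_norm => mv nv.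
apply/andP; rewrite !inE/=; split=> //; apply: le_lt_trans nv.
rewrite unlock; apply: gt0_ler_poweR => //.
- by rewrite in_itv/= leey andbT integral_ge0.
- by rewrite in_itv/= leey andbT integral_ge0.
apply: ge0_le_integral => //.
- by move=> x _; exact: poweR_ge0.
- apply: (measurableT_comp (measurable_poweR 2)).
  by apply: measurableT_comp => //; exact/measurable_EFinP.
- apply: (measurableT_comp (measurable_poweR 2)).
  by apply: measurableT_comp => //; exact/measurable_EFinP.
by move=> x _ /=; rewrite lee_fin ge0_ler_powR ?nnegrE.
Qed.

Lemma Lfun2D (u v : X -> R) : u \in Lfun mu 2%:E -> v \in Lfun mu 2%:E ->
  (fun x => u x + v x) \in Lfun mu 2%:E.
Proof. by move=> Lu Lv; apply: (@rpredD _ _ u v) => //; rewrite lee1n. Qed.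

Lemma Lfun2Z a (u : X -> R) : u \in Lfun mu 2%:E ->
  (fun x => a * u x) \in Lfun mu 2%:E.
Proof.
move=> Lu; rewrite (_ : (fun _ => _) = a \o* u); last first.
  by apply/funext => x /=; rewrite mulrC.
by apply: Lfun_scale => //; rewrite ler1n.
Qed.

Lemma measurable_normc f : cmeasurable f ->
  measurable_fun [set: X] (fun x => normc (f x)).
Proof.
case=> mr mi.
rewrite (_ : (fun _ => _) = (@Num.sqrt R) \o
  (fun x => complex.Re (f x) ^+ 2 + complex.Im (f x) ^+ 2)); last first.
  by apply/funext => x /=; case: (f x).
apply: (@measurableT_comp _ _ _ _ _ _ (@Num.sqrt R)).
  by apply: continuous_measurable_fun; exact: sqrt_continuous.
by apply: measurable_funD; exact: measurable_funX.
Qed.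

Lemma normc_ge0 (z : R[i]) : 0 <= normc z.
Proof. by case: z => a b; rewrite sqrtr_ge0. Qed.

Lemma L2funP f : (f \in L2fun) <->
  (fun x => complex.Re (f x)) \in Lfun mu 2%:E /\
  (fun x => complex.Im (f x)) \in Lfun mu 2%:E.
Proof.
split.
- move=> /asboolP[mf nf].
  have Lf : (fun x => normc (f x)) \in Lfun mu 2%:E.
    rewrite inE; apply/andP; rewrite !inE/=; split=> //.
    exact: measurable_normc.
  case: mf => mr mi; split; apply: Lfun2_dom Lf => // x;
    rewrite (ger0_norm (normc_ge0 _)); case: (f x) => a b /=;
    by rewrite -sqrtr_sqr ler_wsqrtr// ?lerDl ?lerDr sqr_ge0.
- case=> Lr Li.
  have /andP[] := Lr; have /andP[] := Li; rewrite !inE/= => mi _ mr _.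
  have mf : cmeasurable f by [].
  have Lnorm (u : X -> R) : u \in Lfun mu 2%:E ->
      (fun x => `|u x|) \in Lfun mu 2%:E.
    move=> Lu; apply: (Lfun2_dom _ _ Lu); last by move=> x; rewrite normr_id.
    by have /andP[] := Lu; rewrite !inE/= => mu' _; exact: measurableT_comp.
  have Ls := Lfun2D (Lnorm _ Lr) (Lnorm _ Li).
  have /andP[] : (fun x => normc (f x)) \in Lfun mu 2%:E.
    apply: Lfun2_dom Ls; first exact: measurable_normc.
    move=> x; rewrite (ger0_norm (normc_ge0 _)) ger0_norm ?addr_ge0//=.
    case: (f x) => a b /=.
    rewrite -[leRHS]ger0_norm ?addr_ge0// -sqrtr_sqr ler_wsqrtr// sqrrD.
    rewrite !real_normK ?num_real// -addrA lerD2l lerDr mulrn_wge0//.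
  by rewrite !inE/= => _ nf; split.
Qed.

Lemma L2fun_submod_closed : submod_closed L2fun.
Proof.
split.
  apply/L2funP; split; apply: (@rpred0 _ (Lfun mu 2%:E)).
  by rewrite lee1n.
  by rewrite lee1n.
move=> a f g /L2funP[fr fi] /L2funP[gr gi]; apply/L2funP; split.
- rewrite (_ : (fun _ => _) = (fun x => complex.Re a * complex.Re (f x) +
    - complex.Im a * complex.Im (f x) + complex.Re (g x))); last first.
    apply/funext => x; rewrite /= !fctE /=.
    by case: a (f x) (g x) => [a b] [? ?] [? ?] /=; rewrite mulNr.
  by apply: Lfun2D => //; apply: Lfun2D; exact: Lfun2Z.
- rewrite (_ : (fun _ => _) = (fun x => complex.Re a * complex.Im (f x) +
    complex.Im a * complex.Re (f x) + complex.Im (g x))); last first.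
    apply/funext => x; rewrite /= !fctE /=.
    by case: a (f x) (g x) => [a b] [? ?] [? ?].
  by apply: Lfun2D => //; apply: Lfun2D; exact: Lfun2Z.
Qed.

HB.instance Definition _ :=
  GRing.isSubmodClosed.Build _ _ L2fun L2fun_submod_closed.

Record L2rep := MkL2rep { L2rep_fun :> X -> R[i]; _ : L2rep_fun \in L2fun }.

HB.instance Definition _ := [isSub for L2rep_fun].
HB.instance Definition _ := [Choice of L2rep by <:].
HB.instance Definition _ := [SubChoice_isSubLmodule of L2rep by <:].

Definition L2null : {pred L2rep} :=
  fun f : L2rep => `[< {ae mu, forall x, f x = 0} >].

Lemma L2null_zmod_closed : zmod_closed L2null.
Proof.
split; first by apply/asboolP/aeW.
move=> f g /asboolP f0 /asboolP g0; apply/asboolP.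
by apply: filterS2 f0 g0 => x fx gx; rewrite /= !fctE fx gx subr0.
Qed.

HB.instance Definition _ :=
  GRing.isZmodClosed.Build _ L2null L2null_zmod_closed.

Definition L2 : Type := Quotient.quot L2null.
HB.instance Definition _ := GRing.Zmodule.on L2.
HB.instance Definition _ := EqQuotient.on L2.

Lemma L2_eqP (f g : L2rep) :
  \pi_L2 f = \pi_L2 g <-> {ae mu, forall x, f x = g x}.
Proof.
split=> [/eqP|fg].
  rewrite -Quotient.idealrBE => /asboolP; apply: filterS => x /=.
  by move=> /eqP; rewrite subr_eq0 => /eqP.
apply/eqP; rewrite -Quotient.idealrBE; apply/asboolP.
by apply: filterS fg => x fgx; rewrite /= !fctE fgx subrr.
Qed.

Definition L2scale (a : R[i]) (F : L2) : L2 := \pi_L2 (a *: repr F).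

Lemma pi_L2scale a (f : L2rep) : \pi_L2 (a *: f) = L2scale a (\pi_L2 f).
Proof.
apply/L2_eqP; have /L2_eqP := esym (reprK (\pi_L2 f)).
by apply: filterS => x fx; rewrite /= !fctE fx.
Qed.

Lemma pi_L2D (f g : L2rep) : \pi_L2 (f + g) = \pi_L2 f + \pi_L2 g.
Proof. exact: (raddfD \pi_L2). Qed.

Lemma L2scaleA a b F : L2scale a (L2scale b F) = L2scale (a * b) F.
Proof. by rewrite -pi_L2scale scalerA. Qed.

Lemma L2scale1 : left_id 1 L2scale.
Proof. by move=> F; rewrite /L2scale scale1r reprK. Qed.

Lemma L2scaleDr : right_distributive L2scale +%R.
Proof.
move=> a F G; rewrite -[F]reprK -[G]reprK -pi_L2D -!pi_L2scale.
by rewrite scalerDr pi_L2D.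
Qed.

Lemma L2scaleDl F : {morph L2scale^~ F : a b / a + b}.
Proof. by move=> a b; rewrite /L2scale scalerDl pi_L2D. Qed.

HB.instance Definition _ := GRing.Zmodule_isLmodule.Build R[i] L2
  L2scaleA L2scale1 L2scaleDr L2scaleDl.


Definition cintegrable f :=
  mu.-integrable [set: X] (EFin \o (fun x => complex.Re (f x))) /\
  mu.-integrable [set: X] (EFin \o (fun x => complex.Im (f x))).

Lemma Lfun2M_integrable (u v : X -> R) :
  u \in Lfun mu 2%:E -> v \in Lfun mu 2%:E ->
  mu.-integrable [set: X] (EFin \o (fun x => u x * v x)).
Proof. by move=> Lu Lv; apply/Lfun1_integrable; exact: Lfun2_mul_Lfun1. Qed.

Lemma integrable_scale (r : R) (u : X -> R) :
  mu.-integrable [set: X] (EFin \o u) ->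
  mu.-integrable [set: X] (EFin \o (fun x => r * u x)).
Proof. by move=> /(integrableZl measurableT r). Qed.

Lemma integrable_add (u v : X -> R) :
  mu.-integrable [set: X] (EFin \o u) ->
  mu.-integrable [set: X] (EFin \o v) ->
  mu.-integrable [set: X] (EFin \o (fun x => u x + v x)).
Proof. by move=> iu /(integrableD measurableT iu). Qed.

Lemma cintegrable_inner f g : f \in L2fun -> g \in L2fun ->
  cintegrable (fun x => f x * (g x)^*).
Proof.
move=> /L2funP[fr fi] /L2funP[gr gi]; split.
- rewrite (_ : (fun x => complex.Re _) =
    (fun x => complex.Re (f x) * complex.Re (g x) +
              complex.Im (f x) * complex.Im (g x))); last first.
    apply/funext => x.
    by case: (f x) (g x) => a b [c e] /=; rewrite mulrN opprK.
  by apply: integrable_add; exact: Lfun2M_integrable.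
- rewrite (_ : (fun x => complex.Im _) =
    (fun x => complex.Im (f x) * complex.Re (g x) +
              -1 * (complex.Re (f x) * complex.Im (g x)))); last first.
    apply/funext => x.
    by case: (f x) (g x) => a b [c e] /=; rewrite mulrN addrC mulN1r.
  apply: integrable_add; first exact: Lfun2M_integrable.
  by apply: integrable_scale; exact: Lfun2M_integrable.
Qed.

Lemma cintegralP a f g : cintegrable f -> cintegrable g ->
  cintegral (fun x => a * f x + g x) = a * cintegral f + cintegral g.
Proof.
move=> [fr fi] [gr gi]; rewrite /cintegral.
rewrite (_ : (fun x => complex.Re _) = (fun x =>
    complex.Re a * complex.Re (f x) + - complex.Im a * complex.Im (f x) +
    complex.Re (g x))); last first.
  by apply/funext => x; case: a (f x) (g x) => [a b] [? ?] [? ?] /=; rewrite mulNr.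
rewrite (_ : (fun x => complex.Im _) = (fun x =>
    complex.Re a * complex.Im (f x) + complex.Im a * complex.Re (f x) +
    complex.Im (g x))); last first.
  by apply/funext => x; case: a (f x) (g x) => [a b] [? ?] [? ?].
rewrite !RintegralD// ?RintegralZl//; [|by do ?[exact: integrable_scale|apply: integrable_add]..].
by case: a => a b /=; rewrite mulNr.
Qed.

Lemma cintegralJ f : cintegrable f ->
  cintegral (fun x => (f x)^*) = (cintegral f)^*.
Proof.
move=> [fr fi]; rewrite /cintegral /=; congr (_ +i* _).
  by apply: eq_Rintegral => x _; case: (f x).
rewrite -mulN1r -RintegralZl//.
by apply: eq_Rintegral => x _; case: (f x) => a b /=; rewrite mulN1r.
Qed.

Lemma eq_cintegral_ae f g : cintegrable f -> cintegrable g ->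
  {ae mu, forall x, f x = g x} -> cintegral f = cintegral g.
Proof.
move=> [fr fi] [gr gi] fg; rewrite /cintegral.
by congr (_ +i* _); congr fine; apply: ae_eq_integral => //;
  [exact: measurable_int fr|exact: measurable_int gr|
   |exact: measurable_int fi|exact: measurable_int gi|];
  apply: filterS fg => x /= ->.
Qed.

Definition L2dot (F G : L2) : R[i] := inner (repr F) (repr G).

Lemma L2repP (f : L2rep) : (f : X -> R[i]) \in L2fun.
Proof. exact: valP. Qed.

Lemma L2dotE (f g : L2rep) : L2dot (\pi_L2 f) (\pi_L2 g) = inner f g.
Proof.
apply: eq_cintegral_ae; [exact/cintegrable_inner/L2repP/L2repP..|].
have /L2_eqP fE := reprK (\pi_L2 f); have /L2_eqP gE := reprK (\pi_L2 g).
by apply: filterS2 fE gE => x -> ->.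
Qed.

Lemma L2dotC F G : L2dot F G = (-1) ^+ false * Num.conj (L2dot G F).
Proof.
rewrite expr0 mul1r /L2dot /inner.
rewrite -[RHS]cintegralJ; last exact/cintegrable_inner/L2repP/L2repP.
by congr cintegral; apply/funext => x; rewrite rmorphM/= conjcK mulrC.
Qed.

Lemma L2dot_linearl G : linear_for *%R (L2dot^~ G).
Proof.
move=> a F F'; rewrite -[F]reprK -[F']reprK -[G]reprK.
rewrite -[X in L2dot^~ _ (X + _)]/(L2scale _ _) -pi_L2scale -pi_L2D /= !L2dotE.
rewrite /inner.
rewrite -cintegralP; [|exact/cintegrable_inner/L2repP/L2repP..].
by congr cintegral; apply/funext => x; rewrite /= !fctE mulrDl mulrA.
Qed.

Lemma L2dot_bilinear : bilinear_for *%R (Num.conj \; *%R) L2dot.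
Proof.
split=> [G|F a G G']; first exact: L2dot_linearl.
rewrite L2dotC L2dot_linearl expr0 mul1r rmorphD rmorphM/=.
by rewrite [L2dot F G]L2dotC [L2dot F G']L2dotC !expr0 !mul1r.
Qed.

Lemma L2dot_gt0 F : F != 0 -> 0 < L2dot F F.
Proof.
move=> F0; rewrite ltcE /L2dot /=; set f := repr F.
have E x : f x * (f x)^* = (complex.Re (f x) ^+ 2 + complex.Im (f x) ^+ 2)%:C.
  case: (f x) => a b; rewrite -[LHS]/((_ - _) +i* (_ + _)) mulrN opprK -!expr2.
  by congr (_ +i* _); rewrite mulrN mulrC addNr.
apply/andP; split.
  apply/eqP; rewrite (_ : (fun x => complex.Im _) = cst 0).
    by rewrite Rintegral_cst// mul0r.
  by apply/funext => x /=; rewrite E.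
rewrite lt_neqAle Rintegral_ge0 ?andbT; last first.
  by move=> x _; rewrite E addr_ge0 ?sqr_ge0.
have [iu _] := cintegrable_inner (L2repP f) (L2repP f).
apply: contra F0 => /eqP I0; rewrite -[F]reprK -/f.
have I0' : (\int[mu]_x `|(complex.Re (f x * (f x)^*))%:E| = 0)%E.
  under eq_integral => x _.
    rewrite gee0_abs; last by rewrite lee_fin E addr_ge0 ?sqr_ge0.
    over.
  have /esym := congr1 EFin I0; rewrite fineK; last exact: integrable_fin_num.
  exact.
have /(ae_eq_integral_abs _ measurableT) := I0'.
move=> /(_ (measurable_int _ iu)) u0.
apply/eqP; rewrite -(raddf0 \pi_L2); apply/L2_eqP.
apply: filterS u0 => x /(_ I) [].
rewrite E /= => /eqP; rewrite paddr_eq0 ?sqr_ge0// !sqrf_eq0.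
by case: (f x) => a b /= /andP[/eqP-> /eqP->].
Qed.

HB.instance Definition _ :=
  bilinear_isBilinear.Build _ _ _ _ _ _ L2dot L2dot_bilinear.
HB.instance Definition _ :=
  isHermitianSesquilinear.Build _ _ _ _ L2dot L2dotC.
HB.instance Definition _ := isDotProduct.Build _ _ L2dot L2dot_gt0.

End L2functions.

Section CompositionOperator.
Context d (X : measurableType d) (R : realType).
Variables (mu : {measure set X -> \bar R}) (T : X -> X).

Definition non_singular :=
  forall S, measurable S -> mu S = 0%E -> mu (T @^-1` S) = 0%E.

(* The class of f \o T, for a representative f of F; if T is non-singular this
   does not depend on f, and if C_T is bounded then f \o T is in L^2, so that
   the default value of insubd is never used. *)
Definition comp_op (F : L2 mu) : L2 mu :=
  \pi_(L2 mu) (insubd 0 ((repr F : X -> R[i]) \o T)).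

(* When T is measurable so is f \o T, and the inequality then says in
   particular that f \o T is in L^2. *)
Definition comp_op_bounded :=
  exists M : R, forall f, f \in L2fun mu ->
    (L2norm mu (f \o T) <= M%:E * L2norm mu f)%E.

(* The library's 'd nu '/d mu requires nu to be finite. When C_T is bounded
   the density of mu \o T^{-k} is essentially bounded, so it has a real-valued
   version. *)
Definition is_RN_derivative (nu : set X -> \bar R) (h : X -> R) :=
  [/\ measurable_fun [set: X] h,
      (forall x, 0 <= h x) &
      forall S, measurable S -> nu S = (\int[mu]_(x in S) (h x)%:E)%E].

Definition RN_iter (k : nat) : X -> R :=
  if k is 0%N then cst 1
  else xget (cst 0) [set h | is_RN_derivative (pushforward mu (iter k T)) h].

Definition comp_neg_iter (f : X -> R) (m : nat) : X -> R :=
  xget (cst 0) [set g | [/\ measurable_fun [set: X] g,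
    {ae mu, forall x, g (iter m T x) = f x} &
    forall x, RN_iter m x = 0 -> g x = 0]].

(* f \o T^{n - k}, where n - k is an integer of either sign. *)
Definition comp_iter_sub (f : X -> R) (n k : nat) : X -> R :=
  if (k <= n)%N then f \o iter (n - k) T else comp_neg_iter f (k - n).

End CompositionOperator.

(* Main.v *)
(* Write C for the composition operator. Since T^{-m}(Sigma) = Sigma, every f in
   L^2 factors as f = v o T^m, and the change of variables formula
   int (u o T^m) dmu = int h_m u dmu gives C^{*m} (v o T^m) = h_m v. Moving
   adjoints across the inner product, A is k-quasi n-power posinormal iff
   |A^{*n} A^k f| <= lambda |A^{k+1} f| for all f, and for A = C or A = C^* the
   same formula turns both squared norms into weighted integrals of |f|^2. For
   A = C the left-hand weight is h_k g with g o T^k = h_n o T^n a.e.; this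
   single relation characterizes g = h_n o T^{n-k} for both signs of n - k. *)

Require Import Defs.
From HB Require Import structures.
From mathcomp Require Import all_boot all_order all_algebra.
From mathcomp Require Import sesquilinear generic_quotient ring_quotient.
From mathcomp Require Import all_classical all_reals all_analysis.
From mathcomp Require Import measurable_realfun complex.
From mathcomp Require Import ring.
Import Order.TTheory GRing.Theory Num.Theory.
Import numFieldNormedType.Exports.
Local Open Scope classical_set_scope.
Local Open Scope ring_scope.
Local Open Scope complex_scope.

(** * Adjoint pairs in a complex inner product space *)

Section Adjoints.
Set Implicit Arguments.
Unset Strict Implicit.
Context (R : realType) (H : lmodType R[i]) (ip : {dot H for Num.conj}).
Implicit Types A B : H -> H.

(** A symmetric relation in place of the chosen [adjoint], whose values are informative only where a
    representing vector exists. *)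
Definition adjoint_pair A B := forall x y, ip (A x) y = ip x (B y).

Lemma dotC x y : ip x y = (ip y x)^*.
Proof. by rewrite hermC/= expr0 mul1r. Qed.

Lemma dot_eqr y z : (forall x, ip x y = ip x z) -> y = z.
Proof.
move=> yz; apply/eqP; rewrite -subr_eq0; apply/negPn/negP.
move=> /(neq0_dnorm_gt0 (s := ip)).
by rewrite linearBr/= yz subrr ltxx.
Qed.

Lemma adjoint_pairC A B : adjoint_pair A B -> adjoint_pair B A.
Proof. by move=> AB x y; rewrite dotC -AB -dotC. Qed.

Lemma adjointE A B : adjoint_pair A B -> adjoint ip A = B.
Proof.
move=> AB; apply/funext => y; rewrite /adjoint.
case: xgetP => [z _ /= zP|/(_ (B y))/=]; last by case=> x.
by apply: dot_eqr => x; rewrite -zP.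
Qed.

Lemma adjoint_pair_iter A B k :
  adjoint_pair A B -> adjoint_pair (iter k A) (iter k B).
Proof. by move=> AB; elim: k => //= k IH x y; rewrite AB IH -iterSr. Qed.

Lemma adjoint_pair_linear A B : adjoint_pair A B -> linear B.
Proof.
move=> AB a u v; apply: dot_eqr => x.
by rewrite -AB linearPr/= !AB -linearPr.
Qed.

(** Moving [iter k B] across the inner product produces [iter k A x] on the right, the same vector
    as on the left; hence both terms become inner products of a vector with itself. *)
Lemma quasi_posinormalE A B k n : adjoint_pair A B -> bounded_operator ip A ->
  quasi_posinormal ip k n A <->
  exists2 lam : R, 0 < lam & forall x,
    ip (iter n B (iter k A x)) (iter n B (iter k A x)) <=
    (lam ^+ 2)%:C * ip (iter k.+1 A x) (iter k.+1 A x).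
Proof.
move=> AB bA; rewrite /quasi_posinormal (adjointE AB).
have E lam x : ip (iter k B ((lam ^+ 2)%:C *: B (A (iter k A x)) -
      iter n A (iter n B (iter k A x)))) x =
    (lam ^+ 2)%:C * ip (iter k.+1 A x) (iter k.+1 A x) -
    ip (iter n B (iter k A x)) (iter n B (iter k A x)).
  rewrite (adjoint_pair_iter k (adjoint_pairC AB)) linearBl linearZl_LR/=.
  by rewrite (adjoint_pairC AB) (adjoint_pair_iter n AB).
split=> [[_ [lam l0 lamP]]|[lam l0 lamP]].
  by exists lam => // x; move: (lamP x); rewrite E subr_ge0.
by split => //; exists lam => // x; rewrite E subr_ge0; exact: lamP.
Qed.

End Adjoints.

(** * Radon-Nikodym derivatives of measures dominated by a multiple of [mu] *)

Section RadonNikodym.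
Set Implicit Arguments.
Unset Strict Implicit.
Context d (X : measurableType d) (R : realType).

(** On a piece of finite measure of the set where f > C + 1, integration gives (C + 1) mu <= C mu,
    so the piece is null; countably many such pieces suffice. The slack 1 avoids a limit over
    thresholds decreasing to C. *)
Lemma ae_le_of_integral_le (mu : {sigma_finite_measure set X -> \bar R})
    (f : X -> \bar R) (C : R) :
  measurable_fun [set: X] f -> (forall x, 0 <= f x)%E -> 0 <= C ->
  (forall A, measurable A -> \int[mu]_(x in A) f x <= C%:E * mu A)%E ->
  {ae mu, forall x, (f x <= (C + 1)%:E)%E}.
Proof.
move=> mf f0 C0 fC; have [F TF /all_and2[mF muF]] := sigma_finiteT mu.
pose N := [set x | ((C + 1)%:E < f x)%E].
have mN : measurable N by rewrite -[N]setTI; exact: emeasurable_fun_o_infty.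
have N0 j : mu (N `&` F j) = 0%E.
  have mNF : measurable (N `&` F j) by exact: measurableI.
  have muNF : mu (N `&` F j) \is a fin_num.
    rewrite ge0_fin_numE//; apply: le_lt_trans (muF j).
    by apply: le_measure; rewrite ?inE//; exact: subIsetr.
  have : ((C + 1)%:E * mu (N `&` F j) <= C%:E * mu (N `&` F j))%E.
    apply: le_trans (fC _ mNF); rewrite -integral_cst//.
    apply: ge0_le_integral => //.
    - by move=> x _; rewrite lee_fin addr_ge0.
    - exact: measurable_funTS.
    - by move=> x [/ltW].
  rewrite -(fineK muNF) -!EFinM lee_fin mulrDl mul1r gerDl => h.
  by congr EFin; apply/eqP; rewrite eq_le h/= fine_ge0.
suff : mu.-negligible (~` [set x | (f x <= (C + 1)%:E)%E]) by [].
rewrite -[X in _.-negligible X]setIT TF setI_bigcupr.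
apply: negligible_bigcup => j; exists (N `&` F j).
split; [exact: measurableI|exact: N0|].
by move=> x [/= /negP fx Fx]; split => //; rewrite /N/= ltNge.
Qed.

(** On each cell of a countable partition into sets of finite [mu]-measure, [nu] is finite and
    absolutely continuous, hence has a density. The sum of these densities is a density of [nu], and
    the domination by [C] makes it a.e. finite. *)
Lemma RN_derivative_exists (mu : {sigma_finite_measure set X -> \bar R})
    (nu : {measure set X -> \bar R}) (C : R) : 0 <= C ->
  (forall A, measurable A -> nu A <= C%:E * mu A)%E ->
  exists h, is_RN_derivative mu nu h.
Proof.
move=> C0 nuC; have [F TF /all_and2[mF muF]] := sigma_finiteT mu.
pose E := seqDU F.
have mE k : measurable (E k).
  by apply: measurableD => //; exact: bigsetU_measurable.
have muE k : (mu (E k) < +oo)%E.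
  by rewrite (le_lt_trans _ (muF k))// le_measure ?inE//; exact: subDsetl.
have UE : \bigcup_i E i = [set: X] by rewrite TF [RHS]seqDU_bigcup_eq.
have nuE k : (nu (E k) < +oo)%E.
  apply: le_lt_trans (nuC _ (mE k)) _.
  by rewrite lte_mul_pinfty// ?lee_fin.
pose nu_ j : {finite_measure set X -> \bar R} := mfrestr (mE j) (nuE j).
have nu_mu j : nu_ j `<< mu.
  apply/null_content_dominatesP => S mS muS0.
  apply/eqP; rewrite eq_le measure_ge0 andbT /nu_/= /mfrestr /mrestr.
  apply: (le_trans (nuC _ (measurableI _ _ mS (mE j)))).
  rewrite (@subset_measure0 _ _ _ mu _ S) ?mule0//; exact: measurableI.
pose g j := Radon_Nikodym_SigmaFinite.f (nu_ j) mu.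
have g0 j x : (0 <= g j x)%E by exact: Radon_Nikodym_SigmaFinite.f_ge0.
have mg j : measurable_fun [set: X] (g j).
  exact: measurable_int (Radon_Nikodym_SigmaFinite.f_integrable (nu_mu j)).
pose f x := (\sum_(j <oo) g j x)%E.
have f0 x : (0 <= f x)%E by exact: nneseries_ge0.
have mf : measurable_fun [set: X] f by exact: ge0_emeasurable_sum.
have nuf A : measurable A -> nu A = (\int[mu]_(x in A) f x)%E.
  move=> mA; rewrite integral_nneseries//; last first.
    by move=> n; exact: measurable_funTS.
  under eq_eseriesr do rewrite -Radon_Nikodym_SigmaFinite.f_integral//.
  rewrite -[in LHS](setIT A) -UE setI_bigcupr.
  rewrite measure_semi_bigcup//=.
  - by move=> i; exact: measurableI.
  - exact/trivIset_setIl/trivIset_seqDU.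
  - by rewrite -setI_bigcupr UE setIT.
have fC : {ae mu, forall x, (f x <= (C + 1)%:E)%E}.
  by apply: ae_le_of_integral_le => // A mA; rewrite -nuf//; exact: nuC.
(* [fine] sends [+oo] to 0, which changes [f] only on a null set by [fC]. *)
exists (fine \o f); split.
- exact: measurableT_comp.
- by move=> x; rewrite fine_ge0.
move=> A mA; rewrite nuf//; apply: ae_eq_integral => //.
- exact: measurable_funTS.
- by apply/measurable_EFinP/measurable_funTS; exact: measurableT_comp.
apply: filterS fC => x fx _ /=; rewrite fineK// ge0_fin_numE//.
exact: le_lt_trans fx (ltry _).
Qed.

End RadonNikodym.

(** * Integration against a measure with a density *)

Section Density.
Set Implicit Arguments.
Unset Strict Implicit.
Context d (X : measurableType d) (R : realType).
Variables (mu nu : {measure set X -> \bar R}) (h : X -> R).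
Hypothesis hP : is_RN_derivative mu nu h.
Import HBNNSimple.

Let mh : measurable_fun [set: X] (EFin \o h).
Proof. by case: hP => ? _ _; exact/measurable_EFinP. Qed.

Let h0 x : (0 <= (h x)%:E)%E.
Proof. by case: hP => _ h_ge0 _; rewrite lee_fin. Qed.

(** By linearity over the finitely many values of [s], the claim reduces to the defining property of
    the density on each level set. *)
Lemma integral_density_nnsfun (s : {nnsfun X >-> R}) :
  (\int[nu]_x (s x)%:E = \int[mu]_x ((s x)%:E * (h x)%:E))%E.
Proof.
rewrite integralT_nnsfun sintegralE.
under [RHS]eq_integral => x _.
  rewrite (fimfunE s) -fsumEFin// ge0_mule_fsuml; last first.
    by move=> y; exact: nnfun_muleindic_ge0.
  over.
rewrite ge0_integral_fsum//; last 2 first.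
- move=> y; apply: emeasurable_funM => //.
  by apply/measurable_EFinP; exact: measurable_funM.
- by move=> y x _; rewrite mule_ge0// nnfun_muleindic_ge0.
apply: eq_fsbigr => r; rewrite inE => -[t _ rE].
have mr : measurable (s @^-1` [set r]) by [].
under eq_integral do rewrite EFinM -muleA.
rewrite ge0_integralZl//.
- congr *%E; case: hP => _ _ ->//.
  rewrite [LHS]integral_mkcond; apply: eq_integral => x _.
  by rewrite -[RHS]muleC epatch_indic.
- by apply: emeasurable_funM => //; exact/measurable_EFinP.
- by move=> x _; rewrite mule_ge0// lee_fin.
- by rewrite lee_fin -rE.
Qed.

(** Monotone convergence on both sides, along simple functions increasing to [f]. *)
Lemma ge0_integral_density (f : X -> \bar R) :
  measurable_fun [set: X] f -> (forall x, 0 <= f x)%E ->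
  (\int[nu]_x f x = \int[mu]_x (f x * (h x)%:E))%E.
Proof.
move=> mf f0; pose s := nnsfun_approx measurableT mf.
have cs x : (EFin \o s n) x @[n --> \oo] --> f x by exact: cvg_nnsfun_approx.
have nds x : nondecreasing_seq (fun n => (s n x)%:E).
  by move=> a b ab; rewrite lee_fin; exact/lefP/nd_nnsfun_approx.
transitivity (limn (fun n => \int[nu]_x (s n x)%:E)%E).
  rewrite -monotone_convergence//.
  - by apply: eq_integral => x _; apply/esym/cvg_lim => //; exact: cs.
  - by move=> n; exact/measurable_EFinP.
  - by move=> n x _; rewrite lee_fin.
under eq_fun do rewrite integral_density_nnsfun.
rewrite -monotone_convergence//.
- apply: eq_integral => x _; apply/cvg_lim => //.
  by apply: cvgeZr => //; exact: cs.
- by move=> n; apply: emeasurable_funM => //; exact/measurable_EFinP.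
- by move=> n x _; rewrite mule_ge0// lee_fin.
- by move=> x _ a b ab; rewrite lee_wpmul2r//; exact: nds.
Qed.

End Density.

(** * Factoring measurable functions through [T] *)

Section Factorization.
Set Implicit Arguments.
Unset Strict Implicit.
Context d (X : measurableType d) (R : realType) (T : X -> X).
Hypothesis T_sigma : preimage_set_system [set: X] T measurable = measurable.

(** Each set {f < q} with q rational is the preimage under [T] of some measurable [A q]. Put g(y) =
    inf {q : y in A q}; at y = T x this is the infimum of the rationals above f x, which is f x. *)
Lemma measurable_factor (f : X -> R) : measurable_fun [set: X] f ->
  exists2 g, measurable_fun [set: X] g & forall x, g (T x) = f x.
Proof.
move=> mf.
have /choice[A AP] (q : rat) : exists A,
    measurable A /\ T @^-1` A = [set x | f x < ratr q].
  have : measurable [set x | f x < ratr q].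
    rewrite (_ : [set x | _] = [set: X] `&` f @^-1` `]-oo, ratr q[).
      exact: mf.
    by rewrite setTI set_itvE.
  rewrite -[in X in X -> _]T_sigma => -[A mA]; rewrite setTI => AE.
  by exists A.
(* An enumeration of the rationals q with y in [A q]; the default [+oo] leaves the infimum
   unchanged. *)
pose u (n : nat) y : \bar R := if unpickle n is Some q then
  if y \in A q then (ratr q)%:E else +oo%E else +oo%E.
have mu n : measurable_fun [set: X] (u n).
  rewrite /u; case: (unpickle n) => [q|]//.
  apply: measurable_fun_ifT => //.
  apply: (measurable_fun_bool true); rewrite setTI preimage_mem_true.
  by case: (AP q).
pose G y := einfs (u ^~ y) 0%N.
have GT x : G (T x) = (f x)%:E.
  apply/eqP; rewrite eq_le; apply/andP; split.
    apply/lee_addgt0Pr => e e0.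
    have [q] : exists q, ratr q \in `]f x, (f x + e)[%R.
      by apply: rat_in_itvoo; rewrite ltrDl.
    rewrite in_itv/= => /andP[fq qe].
    apply: (@le_trans _ _ (ratr q)%:E); last by rewrite -EFinD lee_fin ltW.
    apply: ereal_inf_lbound; exists (pickle q) => //=.
    rewrite /u pickleK ifT// inE.
    by have [_ ] := AP q; move/seteqP => [_]; apply.
  apply/ereal_infP => _ [n _ <-]; rewrite /u.
  case: (unpickle n) => [q|]; last exact: leey.
  case: ifPn => [/set_mem Aq|_]; last exact: leey.
  have [_ /seteqP[+ _]] := AP q.
  by move=> /(_ x Aq) /ltW; rewrite lee_fin.
(* [G] can be infinite only off the range of [T], where the value of the factor is irrelevant. *)
exists (fine \o G); last by move=> x /=; rewrite GT.
by apply: measurableT_comp => //; exact: measurable_fun_einfs.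
Qed.

Lemma cmeasurable_factor (f : X -> R[i]) : cmeasurable f ->
  exists2 g, cmeasurable g & f = g \o T.
Proof.
case=> /measurable_factor[r mr rE] /measurable_factor[i mi iE].
exists (fun x => r x +i* i x) => //.
by apply/funext => x; rewrite /= rE iE; case: (f x).
Qed.

End Factorization.

(** * Classes of square integrable functions and weighted square norms *)

Section L2Classes.
Set Implicit Arguments.
Unset Strict Implicit.
Import ComplexField.Normc.
Local Open Scope quotient_scope.
Context d (X : measurableType d) (R : realType).
Variable mu : {measure set X -> \bar R}.
Implicit Types (f g : X -> R[i]) (w : X -> R) (F : L2 mu).

Lemma cmeasurableM f g :
  cmeasurable f -> cmeasurable g -> cmeasurable (fun x => f x * g x).
Proof.
move=> [fr fi] [gr gi]; split.
  rewrite (_ : (fun x => complex.Re _) = (fun x =>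
    complex.Re (f x) * complex.Re (g x) - complex.Im (f x) * complex.Im (g x))).
    by apply: measurable_funB; exact: measurable_funM.
  by apply/funext => x; case: (f x) (g x) => [? ?] [? ?].
rewrite (_ : (fun x => complex.Im _) = (fun x =>
  complex.Re (f x) * complex.Im (g x) + complex.Im (f x) * complex.Re (g x))).
  by apply: measurable_funD; exact: measurable_funM.
by apply/funext => x; case: (f x) (g x) => [? ?] [? ?].
Qed.

Lemma cmeasurable_real w :
  measurable_fun [set: X] w -> cmeasurable (fun x => (w x)%:C).
Proof. by move=> mw; split => //=; exact: measurable_cst. Qed.

Lemma cmeasurable_conj g : cmeasurable g -> cmeasurable (fun x => (g x)^*).
Proof.
case=> gr gi; split.
  rewrite (_ : (fun _ => _) = (fun x => complex.Re (g x)))//.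
  by apply/funext => x; case: (g x).
rewrite (_ : (fun _ => _) = -%R \o (fun x => complex.Im (g x))).
  exact: measurableT_comp.
by apply/funext => x /=; case: (g x).
Qed.

Lemma cmeasurable_comp f (T : X -> X) :
  measurable_fun [set: X] T -> cmeasurable f -> cmeasurable (f \o T).
Proof.
move=> mT [fr fi].
by split; [exact: (measurableT_comp fr)|exact: (measurableT_comp fi)].
Qed.

Lemma sqr_normc_conj (z : R[i]) : z * z^* = ((normc z) ^+ 2)%:C.
Proof.
case: z => a b; rewrite -[LHS]/((_ - _) +i* (_ + _)) mulrN opprK -!expr2.
by rewrite sqr_sqrtr ?addr_ge0 ?sqr_ge0// mulrN mulrC addNr.
Qed.

Lemma normc_real (r : R) : normc r%:C = `|r|.
Proof. by rewrite /normc/= expr0n addr0 sqrtr_sqr. Qed.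

(** The squared norm of [f] in L^2(w dmu), for w >= 0. It is extended real, so that it can be
    compared before integrability is known. *)
Definition wnorm2 w f : \bar R :=
  (\int[mu]_x (w x * normc (f x) ^+ 2)%:E)%E.

Lemma L2normE f : L2norm mu f = sqrte (wnorm2 (cst 1%R) f).
Proof.
rewrite /L2norm unlock poweR12_sqrt; last first.
  by apply: integral_ge0 => x _; exact: poweR_ge0.
congr sqrte; apply: eq_integral => x _.
by rewrite /= ger0_norm ?normc_ge0// mul1r powR_mulrn ?normc_ge0.
Qed.

Lemma wnorm2_ge0 w f : (forall x, 0 <= w x) -> (0 <= wnorm2 w f)%E.
Proof.
by move=> w0; apply: integral_ge0 => x _; rewrite lee_fin mulr_ge0 ?sqr_ge0.
Qed.

(** The weight is [Num.sqrt (w x) ^+ 2] and not [w x], because [w] may take negative values, at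
    which [Num.sqrt] is 0. *)
Lemma L2norm_weighted w f : L2norm mu (fun x => (Num.sqrt (w x))%:C * f x) =
  sqrte (wnorm2 (fun x => Num.sqrt (w x) ^+ 2) f).
Proof.
rewrite L2normE; congr sqrte; apply: eq_integral => x _; rewrite mul1r normcM.
by rewrite normc_real ger0_norm ?sqrtr_ge0// exprMn.
Qed.

Lemma lee_sqrteM (lam : R) (a b : \bar R) : 0 < lam -> (0 <= a)%E ->
  (sqrte b <= lam%:E * sqrte a)%E = (b <= (lam ^+ 2)%:E * a)%E.
Proof.
move=> lam0 a0; rewrite -[RHS]lee_sqrt; last first.
  by rewrite mule_ge0// lee_fin sqr_ge0.
by rewrite sqrteM ?lee_fin ?sqr_ge0//= sqrtr_sqr gtr0_norm.
Qed.

Lemma L2funE f :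
  (f \in L2fun mu) <-> cmeasurable f /\ (wnorm2 (cst 1%R) f < +oo)%E.
Proof.
have E : (L2norm mu f < +oo)%E = (wnorm2 (cst 1%R) f < +oo)%E.
  rewrite L2normE -!ge0_fin_numE ?sqrte_ge0 ?wnorm2_ge0//.
  by rewrite sqrte_fin_num ?wnorm2_ge0.
by split => [/asboolP|?]; [|apply/asboolP]; rewrite E.
Qed.

Lemma measurable_wnorm2 w f : measurable_fun [set: X] w -> cmeasurable f ->
  measurable_fun [set: X] (fun x => (w x * normc (f x) ^+ 2)%:E).
Proof.
move=> mw mf; apply/measurable_EFinP; apply: measurable_funM => //.
by apply: measurable_funX; exact: measurable_normc.
Qed.

Lemma ae_le_wnorm2 w w' f :
  (forall x, 0 <= w x) -> (forall x, 0 <= w' x) ->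
  measurable_fun [set: X] w -> measurable_fun [set: X] w' -> cmeasurable f ->
  {ae mu, forall x, w x <= w' x} -> (wnorm2 w f <= wnorm2 w' f)%E.
Proof.
move=> w0 w'0 mw mw' mf ww'; apply: ae_ge0_le_integral => //.
- by move=> x _; rewrite lee_fin mulr_ge0 ?sqr_ge0.
- exact: measurable_wnorm2.
- by move=> x _; rewrite lee_fin mulr_ge0 ?sqr_ge0.
- exact: measurable_wnorm2.
- by apply: filterS ww' => x ww' _; rewrite lee_fin ler_wpM2r ?sqr_ge0.
Qed.

Lemma ae_eq_wnorm2 w w' f :
  measurable_fun [set: X] w -> measurable_fun [set: X] w' -> cmeasurable f ->
  {ae mu, forall x, w x = w' x} -> wnorm2 w f = wnorm2 w' f.
Proof.
move=> mw mw' mf ww'; apply: ae_eq_integral => //; try exact: measurable_wnorm2.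
by apply: filterS ww' => x /= ->.
Qed.

Lemma wnorm2_cst c f : 0 <= c -> cmeasurable f ->
  wnorm2 (cst c) f = (c%:E * wnorm2 (cst 1%R) f)%E.
Proof.
move=> c0 mf; rewrite -ge0_integralZl//.
- by apply: eq_integral => x _; rewrite -EFinM mul1r.
- exact: measurable_wnorm2.
- by move=> x _; rewrite lee_fin mulr_ge0 ?sqr_ge0.
Qed.

Definition L2class f : L2 mu := \pi_(L2 mu) (insubd 0 f).

Lemma L2class_repr F : L2class (repr F) = F.
Proof.
by rewrite /L2class (_ : insubd _ _ = repr F) ?reprK//; exact: valKd.
Qed.

Lemma L2classP (P : L2 mu -> Prop) :
  (forall f, f \in L2fun mu -> P (L2class f)) -> forall F, P F.
Proof. by move=> H F; rewrite -(L2class_repr F); apply/H/L2repP. Qed.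

Lemma insubd_L2fun f : f \in L2fun mu ->
  (insubd (0 : L2rep mu) f : X -> R[i]) = f.
Proof. exact: insubdK. Qed.

Lemma L2class_ae f g : f \in L2fun mu -> g \in L2fun mu ->
  {ae mu, forall x, f x = g x} -> L2class f = L2class g.
Proof. by move=> Lf Lg fg; apply/L2_eqP; rewrite !insubd_L2fun. Qed.

Lemma repr_L2class f : f \in L2fun mu ->
  {ae mu, forall x, (repr (L2class f) : X -> R[i]) x = f x}.
Proof.
move=> Lf; have /L2_eqP := reprK (L2class f).
by rewrite insubd_L2fun.
Qed.

Lemma L2dot_class f g : f \in L2fun mu -> g \in L2fun mu ->
  L2dot (L2class f) (L2class g) = inner mu f g.
Proof. by move=> Lf Lg; rewrite L2dotE !insubd_L2fun. Qed.

Lemma L2fun_linear a f g : f \in L2fun mu -> g \in L2fun mu ->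
  (fun x => a * f x + g x) \in L2fun mu.
Proof. by case: (L2fun_submod_closed mu) => _; apply. Qed.

Lemma L2class_linear a f g : f \in L2fun mu -> g \in L2fun mu ->
  L2class (fun x => a * f x + g x) = a *: L2class f + L2class g.
Proof.
move=> Lf Lg; rewrite -[a *: _]/(L2scale a _) -pi_L2scale -pi_L2D.
congr (\pi_(L2 mu) _); apply: val_inj; rewrite /= insubd_L2fun ?L2fun_linear//.
by apply/funext => x; rewrite /= !fctE !insubd_L2fun.
Qed.

Lemma L2dot_self f : f \in L2fun mu ->
  L2dot (L2class f) (L2class f) = (fine (wnorm2 (cst 1%R) f))%:C.
Proof.
move=> Lf; rewrite L2dot_class// /inner /cintegral.
under eq_Rintegral do rewrite sqr_normc_conj/=.
under [X in _ +i* X]eq_Rintegral do rewrite sqr_normc_conj/=.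
rewrite Rintegral_cst// mul0r; congr (fine _ +i* _).
by apply: eq_integral => x _; rewrite mul1r.
Qed.

End L2Classes.

(** * Change of variables along a map [S] whose image measure has density [h] *)

Section Transfer.
Set Implicit Arguments.
Unset Strict Implicit.
Import ComplexField.Normc.
Context d (X : measurableType d) (R : realType).
Variables (mu : {measure set X -> \bar R}) (S : X -> X) (h : X -> R).
Hypothesis mS : measurable_fun [set: X] S.
Hypothesis hP : is_RN_derivative mu (pushforward mu S) h.
Implicit Types (f : X -> R[i]) (w : X -> R).

Lemma ge0_integral_comp (f : X -> \bar R) :
  measurable_fun [set: X] f -> (forall x, 0 <= f x)%E ->
  (\int[mu]_x f (S x) = \int[mu]_x (f x * (h x)%:E))%E.
Proof.
move=> mf f0; rewrite -(ge0_integral_density hP mf f0)//.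
by rewrite [RHS](ge0_integral_pushforward mS).
Qed.

(** Positive and negative parts are transferred separately; multiplication by h >= 0 commutes with
    taking either part. *)
Lemma integral_comp w : measurable_fun [set: X] w ->
  (\int[mu]_x (w (S x))%:E = \int[mu]_x (h x * w x)%:E)%E.
Proof.
move=> mw; have mEw : measurable_fun [set: X] (EFin \o w).
  exact/measurable_EFinP.
have h0 x : 0 <= h x by case: hP.
rewrite integralE [in RHS]integralE; congr (_ - _)%E.
- rewrite (eq_integral (fun x => (EFin \o w)^\+ (S x))%E); last first.
    by move=> x _; rewrite !funeposE.
  rewrite ge0_integral_comp//; last exact: measurable_funepos.
  apply: eq_integral => x _.
  by rewrite !funeposE/= maxe_pMl ?lee_fin// mul0e -EFinM mulrC.
- rewrite (eq_integral (fun x => (EFin \o w)^\- (S x))%E); last first.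
    by move=> x _; rewrite !funenegE.
  rewrite ge0_integral_comp//; last exact: measurable_funeneg.
  apply: eq_integral => x _.
  by rewrite !funenegE/= maxe_pMl ?lee_fin// mul0e -EFinM mulNr mulrC.
Qed.

Lemma wnorm2_comp w f : measurable_fun [set: X] w -> cmeasurable f ->
  wnorm2 mu (w \o S) (f \o S) = wnorm2 mu (fun x => h x * w x) f.
Proof.
move=> mw mf; rewrite /wnorm2.
rewrite (integral_comp (w := fun x => w x * normc (f x) ^+ 2)).
  by apply: eq_integral => x _; rewrite mulrA.
by apply/measurable_EFinP; exact: measurable_wnorm2.
Qed.

(** The preimage of a null set N is null, its measure being the integral of [h] over N. *)
Lemma ae_comp (P : X -> Prop) :
  {ae mu, forall x, P x} -> {ae mu, forall x, P (S x)}.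
Proof.
case=> N [mN N0 NP]; exists (S @^-1` N); split.
- by rewrite -[X in measurable X]setTI; exact: mS.
- case: hP => mh _ /(_ _ mN); rewrite /pushforward => ->.
  by rewrite null_set_integral//; apply/measurable_EFinP/measurable_funTS.
- by move=> x /= Px; exact: NP.
Qed.

(** The set where w < 0 has null preimage, so [h] integrates to 0 over it and vanishes a.e.
    there. *)
Lemma ae_RN_mul_ge0 w : measurable_fun [set: X] w ->
  {ae mu, forall x, 0 <= w (S x)} -> {ae mu, forall x, 0 <= h x * w x}.
Proof.
move=> mw w0; have [mh h0 hE] := hP.
pose A := [set x | w x < 0].
have mA : measurable A.
  rewrite (_ : A = [set: X] `&` w @^-1` `]-oo, 0[); first exact: mw.
  by rewrite setTI set_itvE.
have : (\int[mu]_(x in A) `|(h x)%:E| = 0)%E.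
  under eq_integral do rewrite gee0_abs ?lee_fin//.
  rewrite -hE// /pushforward; apply: measure_negligible.
    by rewrite -[X in measurable X]setTI; exact: mS.
  apply: negligibleS w0 => x; rewrite /pushforward/= /A/= => wx.
  by apply/negP; rewrite -ltNge.
have mhA : measurable_fun A (EFin \o h).
  by apply/measurable_EFinP; exact: measurable_funTS.
move=> /(proj1 (ae_eq_integral_abs mu mA mhA)); apply: filterS => x hx.
have [wx|wx] := leP 0 (w x).
  exact: mulr_ge0.
by have [->] := hx wx; rewrite mul0r.
Qed.

End Transfer.

(** * The composition operator and the densities of its iterates *)

Section CompositionOperators.
Set Implicit Arguments.
Unset Strict Implicit.
Import ComplexField.Normc.
Context d (X : measurableType d) (R : realType).
Variables (mu : {sigma_finite_measure set X -> \bar R}) (T : X -> X).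
Hypothesis T_meas : measurable_fun [set: X] T.
Hypothesis CT_bounded : comp_op_bounded mu T.
Implicit Types (f g : X -> R[i]) (w : X -> R) (F G : L2 mu).

Let h := RN_iter mu T.

Lemma measurable_iter m : measurable_fun [set: X] (iter m T).
Proof.
elim: m => [|m IH]; first exact: measurable_id.
exact: (measurableT_comp (f := T) T_meas IH).
Qed.

Let measurable_preimage A : measurable A -> measurable (T @^-1` A).
Proof. by move=> mA; rewrite -[X in measurable X]setTI; exact: T_meas. Qed.

(** The operator bound is tested on the indicator of A, whose squared norm is mu A and whose
    composition with T is the indicator of the preimage. *)
Lemma measure_preimage_le : exists2 C : R, 0 < C &
  forall A, measurable A -> (mu (T @^-1` A) <= C%:E * mu A)%E.
Proof.
have [M MP] := CT_bounded.
(* The summand 1 keeps the constant positive even if M = 0, so that the bound is [+oo] when A has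
   infinite measure and its indicator is not in L^2. *)
have C0 : 0 < M ^+ 2 + 1 by rewrite ltr_pwDr// sqr_ge0.
exists (M ^+ 2 + 1) => // A mA.
have [->|/eqP muA] := eqVneq (mu A) +oo%E.
  by rewrite gt0_muley ?lte_fin ?leey.
pose f x : R[i] := (\1_A x : R)%:C.
have mf : cmeasurable f by exact: cmeasurable_real.
have nE (B : set X) : measurable B ->
    wnorm2 mu (cst 1) (fun x => (\1_B x : R)%:C) = mu B.
  move=> mB; rewrite -[in RHS](setIT B) -integral_indic//.
  apply: eq_integral => x _; rewrite mul1r normc_real indicE.
  by case: (x \in B); rewrite ?normr1 ?normr0 ?expr1n ?expr0n.
have Lf : f \in L2fun mu.
  by apply/L2funE; split => //; rewrite nE// ltey; apply/eqP.
have := MP _ Lf.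
rewrite !L2normE (nE _ mA).
rewrite -[X in wnorm2 _ _ X]/(fun x => (\1_(T @^-1` A) x : R)%:C).
rewrite (nE _ (measurable_preimage mA)) => MA.
rewrite -(sqr_sqrtr (ltW C0)) -lee_sqrteM ?sqrtr_gt0//.
apply: le_trans MA _; rewrite lee_wpmul2r ?sqrte_ge0// lee_fin.
rewrite (le_trans (ler_norm _))// -sqrtr_sqr ler_wsqrtr// lerDl//.
Qed.

Lemma measure_preimage_iter_le m : exists2 C : R, 0 <= C &
  forall A, measurable A -> (mu (iter m T @^-1` A) <= C%:E * mu A)%E.
Proof.
have [C C0 CP] := measure_preimage_le; exists (C ^+ m) => [|A mA].
  by rewrite exprn_ge0// ltW.
elim: m A mA => [|m IH] A mA; first by rewrite expr0 mul1e.
rewrite -[iter m.+1 T @^-1` A]/(iter m T @^-1` (T @^-1` A)).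
apply: le_trans (IH _ (measurable_preimage mA)) _.
rewrite exprSr EFinM -muleA lee_wpmul2l ?lee_fin ?exprn_ge0 ?(ltW C0)//.
exact: CP.
Qed.

(** The image measure is dominated by a multiple of [mu], so a derivative exists and the default
    value of [xget] is not taken. *)
Lemma RN_iterP m : is_RN_derivative mu (pushforward mu (iter m T)) (h m).
Proof.
case: m => [|m].
  split => [|x|A mA]; [exact: measurable_cst|exact: ler01|].
  by rewrite -[RHS]/(\int[mu]_(x in A) cst 1%E x)%E integral_cst// mul1e.
have [C C0 CP] := measure_preimage_iter_le m.+1.
rewrite /h /RN_iter; case: xgetP => [g _ //|/= no].
have /(_ (measurable_iter m.+1))[g gP] := RN_derivative_exists
  (nu := pushforward mu (iter m.+1 T)) C0 CP.
by have := no g.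
Qed.

Lemma measurable_RN_iter m : measurable_fun [set: X] (h m).
Proof. by case: (RN_iterP m). Qed.

Lemma RN_iter_ge0 m x : 0 <= h m x.
Proof. by case: (RN_iterP m). Qed.

Lemma RN_iter_bounded m :
  exists2 C : R, 0 <= C & {ae mu, forall x, h m x <= C}.
Proof.
have [C C0 CP] := measure_preimage_iter_le m.
have [mh _ hE] := RN_iterP m.
exists (C + 1); first by rewrite addr_ge0.
have : {ae mu, forall x, ((h m x)%:E <= (C + 1)%:E)%E}.
  apply: ae_le_of_integral_le => //.
  - exact/measurable_EFinP.
  - by move=> x; rewrite lee_fin RN_iter_ge0.
  - by move=> A mA; rewrite -hE//; exact: CP.
by apply: filterS => x; rewrite lee_fin.
Qed.

Lemma wnorm2_comp_iter m f : cmeasurable f ->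
  wnorm2 mu (cst 1) (f \o iter m T) = wnorm2 mu (h m) f.
Proof.
move=> mf.
rewrite -[cst 1]/(cst (1 : R) \o iter m T).
rewrite (wnorm2_comp (measurable_iter m) (RN_iterP m))//.
by apply: eq_integral => x _; rewrite mulr1.
Qed.

Lemma wnorm2_bounded w C f :
  measurable_fun [set: X] w -> (forall x, 0 <= w x) -> 0 <= C ->
  {ae mu, forall x, w x <= C} -> cmeasurable f ->
  (wnorm2 mu w f <= C%:E * wnorm2 mu (cst 1%R) f)%E.
Proof.
move=> mw w0 C0 wC mf; rewrite -wnorm2_cst//.
by apply: ae_le_wnorm2 => //; exact: measurable_cst.
Qed.

Lemma wnorm2_lty w C f :
  measurable_fun [set: X] w -> (forall x, 0 <= w x) -> 0 <= C ->
  {ae mu, forall x, w x <= C} -> f \in L2fun mu -> (wnorm2 mu w f < +oo)%E.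
Proof.
move=> mw w0 C0 wC /L2funE[mf nf].
apply: le_lt_trans (wnorm2_bounded _ _ _ wC mf) _ => //.
by rewrite lte_mul_pinfty// lee_fin.
Qed.

Lemma L2fun_comp m f : f \in L2fun mu -> f \o iter m T \in L2fun mu.
Proof.
move=> Lf; have /L2funE[mf _] := Lf; apply/L2funE; split.
  exact: cmeasurable_comp (measurable_iter m) mf.
have [C C0 hC] := RN_iter_bounded m.
rewrite wnorm2_comp_iter//; apply: wnorm2_lty hC Lf => //.
  exact: measurable_RN_iter.
exact: RN_iter_ge0.
Qed.

(** [comp_op] composes a chosen representative with [T]; it agrees with [f] a.e., and [ae_comp]
    preserves this under composition. *)
Lemma comp_op_class f : f \in L2fun mu ->
  comp_op T (L2class mu f) = L2class mu (f \o T).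
Proof.
move=> Lf; apply: L2class_ae.
- exact: (L2fun_comp 1 (L2repP _)).
- exact: (L2fun_comp 1 Lf).
- exact: (ae_comp (measurable_iter 1) (RN_iterP 1) (repr_L2class Lf)).
Qed.

Lemma comp_op_iter m f : f \in L2fun mu ->
  iter m (comp_op T) (L2class mu f) = L2class mu (f \o iter m T).
Proof.
move=> Lf; elim: m => //= m ->; rewrite comp_op_class; last exact: L2fun_comp.
by congr L2class; apply/funext => x /=; rewrite -iterSr.
Qed.

Lemma comp_op_linear : linear (comp_op T : L2 mu -> L2 mu).
Proof.
move=> a; apply: L2classP => f Lf; apply: L2classP => g Lg.
rewrite -L2class_linear// !comp_op_class// ?L2fun_linear//.
by rewrite -L2class_linear//; exact: (L2fun_comp 1).
Qed.

Lemma hnorm_le (A : L2 mu -> L2 mu) (C : R) : 0 <= C ->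
  (forall F, L2dot (A F) (A F) <= C%:C * L2dot F F) ->
  forall F, hnorm (@L2dot d X R mu) (A F) <=
    Num.sqrt C * hnorm (@L2dot d X R mu) F.
Proof.
move=> C0 AC F; rewrite /hnorm -sqrtrM// ler_wsqrtr//.
have := AC F; rewrite lecE => /andP[_ AF]; apply: le_trans AF _.
rewrite -[X in _ <= _ * complex.Re X]/(L2dot F F); case: (L2dot F F) => a b.
by rewrite -[X in X <= _]/(C * a - 0 * b) mul0r subr0.
Qed.

Lemma lec_fine (c : R) (a b : \bar R) : a \is a fin_num -> b \is a fin_num ->
  ((fine a)%:C <= c%:C * (fine b)%:C) = (a <= c%:E * b)%E.
Proof.
move=> fa fb.
by rewrite -rmorphM/= lecR -lee_fin EFinM !fineK.
Qed.

Lemma wnorm2_fin_num f : f \in L2fun mu -> wnorm2 mu (cst 1) f \is a fin_num.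
Proof. by move=> /L2funE[_ ?]; rewrite ge0_fin_numE// wnorm2_ge0. Qed.

Lemma wnorm2M w u f :
  wnorm2 mu w (fun x => (u x)%:C * f x) = wnorm2 mu (fun x => w x * u x ^+ 2) f.
Proof.
apply: eq_integral => x _.
by rewrite normcM normc_real exprMn -normrX ger0_norm ?sqr_ge0// mulrA.
Qed.

(** Of the two factors in h_m^2 |v|^2, one is absorbed as the density of the change of variables and
    the other remains as weight. *)
Lemma wnorm2_RN m v : cmeasurable v ->
  wnorm2 mu (cst 1) (fun x => (h m x)%:C * v x) =
  wnorm2 mu (h m \o iter m T) (v \o iter m T).
Proof.
move=> mv; rewrite wnorm2M (wnorm2_comp (measurable_iter m) (RN_iterP m))//.
  by apply: eq_integral => x _; rewrite mul1r expr2.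
exact: measurable_RN_iter.
Qed.

Lemma RN_comp_bounded m : exists2 C : R, 0 <= C &
  {ae mu, forall x, h m (iter m T x) <= C}.
Proof.
have [C C0 hC] := RN_iter_bounded m; exists C => //.
exact: (ae_comp (measurable_iter m) (RN_iterP m) hC).
Qed.

Lemma measurable_RN_comp m j : measurable_fun [set: X] (h m \o iter j T).
Proof.
exact: (measurableT_comp (measurable_RN_iter m) (measurable_iter j)).
Qed.

(** The assumption bears on the composite because [v] itself need not be in L^2: it is arbitrary
    where h_m vanishes. *)
Lemma L2fun_RN m v : cmeasurable v -> v \o iter m T \in L2fun mu ->
  (fun x => (h m x)%:C * v x) \in L2fun mu.
Proof.
move=> mv Lv; apply/L2funE; split.
  apply: cmeasurableM => //; apply: cmeasurable_real.
  exact: measurable_RN_iter.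
have [C C0 hC] := RN_comp_bounded m.
rewrite wnorm2_RN//; apply: wnorm2_lty hC Lv => //.
  exact: measurable_RN_comp.
by move=> x; exact: RN_iter_ge0.
Qed.

Lemma inner_comp_iter m f v : cmeasurable f -> cmeasurable v ->
  inner mu (f \o iter m T) (v \o iter m T) =
  inner mu f (fun x => (h m x)%:C * v x).
Proof.
move=> mf mv; rewrite /inner /cintegral.
have [mr mi] := cmeasurableM mf (cmeasurable_conj mv).
congr (fine _ +i* fine _).
- rewrite (integral_comp (measurable_iter m) (RN_iterP m) mr).
  apply: eq_integral => x _; congr EFin.
  by case: (f x) (v x) => [a b] [a' b'] /=; ring.
- rewrite (integral_comp (measurable_iter m) (RN_iterP m) mi).
  apply: eq_integral => x _; congr EFin.
  by case: (f x) (v x) => [a b] [a' b'] /=; ring.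
Qed.

Lemma L2dot_comp_iter m F v : cmeasurable v -> v \o iter m T \in L2fun mu ->
  L2dot (iter m (comp_op T) F) (L2class mu (v \o iter m T)) =
  L2dot F (L2class mu (fun x => (h m x)%:C * v x)).
Proof.
move=> mv Lv; elim/L2classP: F => f Lf; have /L2funE[mf _] := Lf.
rewrite comp_op_iter// L2dot_class//; last exact: L2fun_comp.
by rewrite inner_comp_iter// -L2dot_class//; exact: L2fun_RN.
Qed.

(** * The adjoint of the composition operator, and the weights of the resulting norms *)

Hypothesis T_sigma : forall m : nat,
  preimage_set_system [set: X] (iter m T) measurable = measurable.

Lemma L2fun_factor m f : f \in L2fun mu ->
  exists2 v, cmeasurable v & f = v \o iter m T.
Proof. by move=> /L2funE[mf _]; exact: cmeasurable_factor. Qed.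

(** The representing vector is explicit: for the class of v o T it is the class of h_1 v. *)
Lemma comp_op_adjoint_exists :
  exists B, adjoint_pair (@L2dot d X R mu) (comp_op T) B.
Proof.
have /choice[B BP] : forall F, exists G, forall E,
    L2dot (comp_op T E) F = L2dot E G.
  apply: L2classP => f Lf; have [v mv fE] := L2fun_factor 1 Lf.
  exists (L2class mu (fun x => (h 1 x)%:C * v x)) => E.
  by rewrite fE -L2dot_comp_iter// -fE.
by exists B => F G; exact: BP.
Qed.

Variable B : L2 mu -> L2 mu.
Hypothesis CB : adjoint_pair (@L2dot d X R mu) (comp_op T) B.

(** Both sides have the same inner product with every F. The change of variables along T^m handles
    all m at once, without induction. *)
Lemma adjoint_comp_iter m v : cmeasurable v -> v \o iter m T \in L2fun mu ->
  iter m B (L2class mu (v \o iter m T)) =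
  L2class mu (fun x => (h m x)%:C * v x).
Proof.
move=> mv Lv; apply: (dot_eqr (ip := @L2dot d X R mu)) => F.
by rewrite -(adjoint_pair_iter m CB); exact: L2dot_comp_iter.
Qed.

Lemma comp_op_bounded_operator :
  bounded_operator (@L2dot d X R mu) (comp_op T).
Proof.
split; first exact: comp_op_linear.
have [C C0 hC] := RN_iter_bounded 1.
exists (Num.sqrt C); apply: hnorm_le => //; apply: L2classP => f Lf.
have LfT := L2fun_comp 1 Lf; have /L2funE[mf _] := Lf.
rewrite (comp_op_class Lf) !L2dot_self// lec_fine ?wnorm2_fin_num//.
rewrite (wnorm2_comp_iter 1 mf); apply: wnorm2_bounded => //.
  exact: measurable_RN_iter.
exact: RN_iter_ge0.
Qed.

(** The squared norm of B f is that of f with weight h_1 o T, which is essentially bounded. *)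
Lemma adjoint_bounded_operator : bounded_operator (@L2dot d X R mu) B.
Proof.
split; first exact: adjoint_pair_linear CB.
have [C C0 hC] := RN_comp_bounded 1.
exists (Num.sqrt C); apply: hnorm_le => //; apply: L2classP => f Lf.
have [v mv fE] := L2fun_factor 1 Lf; rewrite fE in Lf *.
have Lhv := L2fun_RN mv Lf; have /L2funE[mf _] := Lf.
have -> : B (L2class mu (v \o iter 1 T)) =
    L2class mu (fun x => (h 1 x)%:C * v x).
  exact: (adjoint_comp_iter (m := 1)).
rewrite !L2dot_self//.
rewrite lec_fine ?wnorm2_fin_num// wnorm2_RN//; apply: wnorm2_bounded => //.
  exact: measurable_RN_comp.
by move=> x; exact: RN_iter_ge0.
Qed.

Lemma comp_neg_iterP m w : measurable_fun [set: X] w ->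
  measurable_fun [set: X] (comp_neg_iter mu T w m) /\
  {ae mu, forall x, comp_neg_iter mu T w m (iter m T x) = w x}.
Proof.
move=> mw; rewrite /comp_neg_iter; case: xgetP => [g _ []//|/= no].
have [g mg gE] := measurable_factor (T_sigma m) mw.
have [mh _ hE] := RN_iterP m; pose A := h m @^-1` [set 0].
have mA : measurable A by rewrite -[A]setTI; exact: mh.
(* The factor [g] of [w] is cut off to 0 on A, the zero set of h_m. The preimage of A under T^m has
   measure equal to the integral of h_m over A, that is 0, so the factorization survives a.e. *)
case: (no (fun x => g x * \1_(~` A) x)); split.
- by apply: measurable_funM => //; apply: measurable_indic; exact: measurableC.
- exists (iter m T @^-1` A); split.
  + by rewrite -[X in measurable X]setTI; exact: measurable_iter.
  + rewrite -[LHS]/(pushforward mu (iter m T) A) hE//.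
    by apply: integral0_eq => x; rewrite /A/= => ->.
  + move=> x /=; apply: contra_notP => hx.
    by rewrite gE indicE mem_set ?mulr1.
- by move=> x hx; rewrite indicE memNset ?mulr0//; apply/not_notP.
Qed.

Lemma comp_iter_subP n k w : measurable_fun [set: X] w ->
  measurable_fun [set: X] (comp_iter_sub mu T w n k) /\
  {ae mu, forall x, comp_iter_sub mu T w n k (iter k T x) = w (iter n T x)}.
Proof.
move=> mw; rewrite /comp_iter_sub; case: leqP => [kn|nk].
  split; first exact: (measurableT_comp mw (measurable_iter _)).
  by apply: aeW => x /=; rewrite -iterD subnK.
have [mg gE] := comp_neg_iterP (k - n) mw; split => //.
(* Composing g o T^{k-n} = w with T^n gives g o T^k = w o T^n. *)
have := ae_comp (measurable_iter n) (RN_iterP n) gE.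
by apply: filterS => x; rewrite -iterD subnK// ltnW.
Qed.

(** Encodes |P f|^2 = int w |f|^2 dmu, with an explicit representative [g] of the image on which the
    norm is computed. *)
Definition sqnorm_weight (P : L2 mu -> L2 mu) w :=
  forall f, f \in L2fun mu -> exists g, [/\ g \in L2fun mu,
    P (L2class mu f) = L2class mu g & wnorm2 mu (cst 1) g = wnorm2 mu w f].

(** For each [f] and each positive [lam] the two inequalities are equivalent, one being the square
    of the other; the same [lam] serves in both directions. *)
Lemma sqnorm_weight_domination (P Q : L2 mu -> L2 mu) w1 w2 :
  sqnorm_weight P (fun x => Num.sqrt (w1 x) ^+ 2) ->
  sqnorm_weight Q (fun x => Num.sqrt (w2 x) ^+ 2) ->
  (exists2 lam : R, 0 < lam &
     forall F, L2dot (Q F) (Q F) <= (lam ^+ 2)%:C * L2dot (P F) (P F)) <->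
  (exists2 lam : R, 0 < lam & forall f, f \in L2fun mu ->
     (lam%:E * L2norm mu (fun x => (Num.sqrt (w1 x))%:C * f x)%R
      >= L2norm mu (fun x => (Num.sqrt (w2 x))%:C * f x)%R)%E).
Proof.
move=> Pw Qw.
have E lam f : 0 < lam -> f \in L2fun mu ->
    (L2dot (Q (L2class mu f)) (Q (L2class mu f)) <=
      (lam ^+ 2)%:C * L2dot (P (L2class mu f)) (P (L2class mu f))) =
    (L2norm mu (fun x => (Num.sqrt (w2 x))%:C * f x)%R <=
      lam%:E * L2norm mu (fun x => (Num.sqrt (w1 x))%:C * f x)%R)%E.
  move=> lam0 Lf; rewrite !L2norm_weighted lee_sqrteM//; last first.
    by apply: wnorm2_ge0 => x; exact: sqr_ge0.
  have [g [Lg -> <-]] := Pw _ Lf; have [g' [Lg' -> <-]] := Qw _ Lf.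
  by rewrite !L2dot_self// lec_fine// wnorm2_fin_num.
split => -[lam lam0 lamP]; exists lam => //.
  by move=> f Lf; rewrite -E.
by apply: L2classP => f Lf; rewrite E//; exact: lamP.
Qed.

Lemma sqnorm_weight_comp_op m :
  sqnorm_weight (iter m (comp_op T)) (fun x => Num.sqrt (h m x) ^+ 2).
Proof.
move=> f Lf; have /L2funE[mf _] := Lf.
exists (f \o iter m T); split; [exact: L2fun_comp|exact: comp_op_iter|].
rewrite wnorm2_comp_iter//; apply: eq_integral => x _.
by rewrite sqr_sqrtr ?RN_iter_ge0.
Qed.

Lemma sqnorm_weight_adjoint m :
  sqnorm_weight (iter m B) (fun x => Num.sqrt (h m (iter m T x)) ^+ 2).
Proof.
move=> f Lf; have [v mv fE] := L2fun_factor m Lf; rewrite fE in Lf *.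
exists (fun x => (h m x)%:C * v x).
split; [exact: L2fun_RN|exact: adjoint_comp_iter|].
rewrite wnorm2_RN//; apply: eq_integral => x _.
by rewrite sqr_sqrtr ?RN_iter_ge0.
Qed.

(** Write f o T^k = v o T^n. The image is then h_n v, with squared norm int (h_n o T^n) |f o T^k|^2
    dmu. Replacing h_n o T^n by c o T^k, where c stands for h_n o T^{n-k}, makes the integrand a
    function of T^k x, and the change of variables gives the weight h_k c. *)
Lemma sqnorm_weight_adjoint_comp_op n k :
  sqnorm_weight (fun F => iter n B (iter k (comp_op T) F))
    (fun x => Num.sqrt (h k x * comp_iter_sub mu T (h n) n k x) ^+ 2).
Proof.
move=> f Lf; have /L2funE[mf _] := Lf.
have LfT := L2fun_comp k Lf; have [v mv fE] := L2fun_factor n LfT.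
have Lv := LfT; rewrite fE in Lv.
exists (fun x => (h n x)%:C * v x); split; first exact: L2fun_RN.
  by rewrite comp_op_iter// fE; exact: adjoint_comp_iter.
rewrite wnorm2_RN// -fE.
have [mc cE] := comp_iter_subP n k (measurable_RN_iter n).
set c := comp_iter_sub _ _ _ _ _ in mc cE *.
(* [c] may be negative on a set with null preimage under [T^k]; there [h k] = 0
   a.e., so the value [0] of [Num.sqrt] at negative arguments does no harm. *)
have c0 : {ae mu, forall x, 0 <= h k x * c x}.
  apply: (ae_RN_mul_ge0 (measurable_iter k) (RN_iterP k) mc).
  by apply: filterS cE => x ->; exact: RN_iter_ge0.
have mhc : measurable_fun [set: X] (fun x => h k x * c x).
  by apply: measurable_funM => //; exact: measurable_RN_iter.
have mck : measurable_fun [set: X] (c \o iter k T).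
  exact: (measurableT_comp mc (measurable_iter k)).
have mfk := cmeasurable_comp (measurable_iter k) mf.
transitivity (wnorm2 mu (c \o iter k T) (f \o iter k T)).
  apply: ae_eq_wnorm2 => //; first exact: measurable_RN_comp.
  by apply: filterS cE => x /= ->.
rewrite (wnorm2_comp (measurable_iter k) (RN_iterP k))//.
apply: ae_eq_wnorm2 => //.
  apply: measurable_funX; apply: (measurableT_comp (f := @Num.sqrt R)) => //.
  by apply: continuous_measurable_fun; exact: sqrt_continuous.
by apply: filterS c0 => x ?; rewrite sqr_sqrtr.
Qed.

(** For f = v o T^k the image is (h_k v) o T^n, with squared norm int h_n h_k^2 |v|^2 dmu. One
    factor h_k is spent on returning from v to f by the change of variables along T^k. *)
Lemma sqnorm_weight_comp_op_adjoint n k :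
  sqnorm_weight (fun F => iter n (comp_op T) (iter k B F))
    (fun x => Num.sqrt (h n (iter k T x) * h k (iter k T x)) ^+ 2).
Proof.
move=> f Lf; have [v mv fE] := L2fun_factor k Lf; rewrite fE in Lf *.
have Lhv := L2fun_RN mv Lf; have /L2funE[mhv _] := Lhv.
exists ((fun x => (h k x)%:C * v x) \o iter n T); split.
- exact: L2fun_comp.
- by rewrite adjoint_comp_iter// comp_op_iter.
rewrite wnorm2_comp_iter// wnorm2M.
pose w x := h n x * h k x.
have mw : measurable_fun [set: X] w.
  by apply: measurable_funM; exact: measurable_RN_iter.
transitivity (wnorm2 mu (w \o iter k T) (v \o iter k T)).
  rewrite (wnorm2_comp (measurable_iter k) (RN_iterP k))//.
  by apply: eq_integral => x _; congr EFin; rewrite /w; ring.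
apply: eq_integral => x _.
by rewrite /w sqr_sqrtr// mulr_ge0// RN_iter_ge0.
Qed.

End CompositionOperators.

(** * The characterizations for the operator and for its adjoint *)

Theorem theorem2p2 (d : measure_display) (X : measurableType d) (R : realType)
  (mu : {sigma_finite_measure set X -> \bar R})
  (mu_complete : measure_is_complete mu)
  (T : X -> X)
  (T_meas : measurable_fun [set: X] T)
  (T_nonsing : non_singular mu T)
  (CT_bounded : comp_op_bounded mu T)
  (T_sigma : forall k : nat,
    preimage_set_system [set: X] (iter k T) measurable = measurable)
  (k n : nat) (n_ge1 : (1 <= n)%N) :
  let h := RN_iter mu T in
  (quasi_posinormal (@L2dot d X R mu) k n (comp_op T) <->
   exists2 lam : R, 0 < lam &
     forall f : X -> R[i], f \in L2fun mu ->
       (lam%:E * L2norm mu (fun x => (Num.sqrt (h k.+1 x))%:C * f x)%R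
        >= L2norm mu (fun x =>
             (Num.sqrt (h k x * comp_iter_sub mu T (h n) n k x))%:C * f x)%R)%E)
  /\
  (quasi_posinormal (@L2dot d X R mu) k n
     (adjoint (@L2dot d X R mu) (comp_op T)) <->
   exists2 lam : R, 0 < lam &
     forall f : X -> R[i], f \in L2fun mu ->
       (lam%:E * L2norm mu
          (fun x => (Num.sqrt (h k.+1 (iter k.+1 T x)))%:C * f x)%R
        >= L2norm mu (fun x =>
             (Num.sqrt (h n (iter k T x) * h k (iter k T x)))%:C * f x)%R)%E).
Proof.
move=> h.
have [B CB] := comp_op_adjoint_exists T_meas CT_bounded T_sigma.
rewrite (adjointE CB); split.
- apply: iff_trans; first exact: (quasi_posinormalE k n CB
    (comp_op_bounded_operator T_meas CT_bounded)).
  apply: sqnorm_weight_domination.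
    exact: (sqnorm_weight_comp_op T_meas CT_bounded k.+1).
  exact: sqnorm_weight_adjoint_comp_op.
(* The operator is now [B], whose adjoint is [comp_op T] by symmetry of adjoint pairs. *)
- apply: iff_trans; first exact: (quasi_posinormalE k n (adjoint_pairC CB)
    (adjoint_bounded_operator T_meas CT_bounded T_sigma CB)).
  apply: sqnorm_weight_domination.
    exact: (sqnorm_weight_adjoint T_meas CT_bounded T_sigma CB k.+1).
  exact: sqnorm_weight_comp_op_adjoint.
Qed.
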